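(* Let $m$ be a positive integer and let $p_0,\dots,p_m\ge 0$ be real numbers with $\sum_{k=0}^m p_k=1$. Let $S$ be a random variable with $P\{S=k\}=p_k$ for $k=0,\dots,m$. Then there exists a unique joint distribution of $\{0,1\}$-valued random variables $X_1,\dots,X_m$ (that is, a unique probability measure on $\{0,1\}^m$) such that $X_1,\dots,X_m$ are exchangeable and $\sum_{i=1}^m X_i$ has the same distribution as $S$.
   Context: $\{0,1\}$-valued random variables $X_1,\dots,X_m$ are exchangeable if their joint distribution on $\{0,1\}^m$ is invariant under every permutation of the $m$ coordinates. *)

(* Defs.v *)
From HB Require Import structures.
From mathcomp Require Import all_boot all_algebra perm.
From mathcomp Require Import all_classical all_reals all_analysis.

Set Implicit Arguments.
Unset Strict Implicit.
Unset Printing Implicit Defensive.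

Import GRing.Theory Num.Theory.

Local Open Scope classical_set_scope.
Local Open Scope ring_scope.

(* The set {0,1} is the type [bool], and {0,1}^m is [m.-tuple bool] with the
   product sigma-algebra. Every subset of [m.-tuple bool] is measurable, so two
   terms of type [probability (m.-tuple bool) R] are equal as soon as they agree
   as measures. *)

Section joint.
Context (d : measure_display) (Omega : measurableType d) (R : realType).
Context (P : probability Omega R) (m : nat) (X : 'I_m -> {RV P >-> bool}).

Definition joint_fun (w : Omega) : m.-tuple bool := [tuple X i w | i < m].

Lemma measurable_joint_fun : measurable_fun setT joint_fun.
Proof.
apply/measurable_fun_tnthP => i.
apply: (@eq_measurable_fun _ _ _ _ _ (X i)); last exact: measurable_funPT.
by move=> w _; rewrite /= /joint_fun tnth_mktuple.
Qed.

HB.instance Definition _ :=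
  isMeasurableFun.Build _ _ _ _ joint_fun measurable_joint_fun.

Definition jointRV : {RV P >-> m.-tuple bool} := joint_fun.

Definition sum_fun (w : Omega) : R := \sum_(i < m) (X i w)%:R.

Lemma measurable_sum_fun : measurable_fun setT sum_fun.
Proof.
apply: measurable_sum => i.
by apply: (measurableT_comp (f := fun b : bool => b%:R : R)).
Qed.

HB.instance Definition _ :=
  isMeasurableFun.Build _ _ _ _ sum_fun measurable_sum_fun.

Definition sumRV : {RV P >-> R} := sum_fun.

End joint.

(* [distribution P Y] is a function on all subsets of the codomain, so it is
   compared on measurable sets only. *)
Definition same_distribution (d1 d2 d : measure_display)
    (T1 : measurableType d1) (T2 : measurableType d2) (T : measurableType d)
    (R : realType) (P1 : probability T1 R) (P2 : probability T2 R)
    (Y : {RV P1 >-> T}) (Z : {RV P2 >-> T}) : Prop :=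
  forall A : set T, measurable A -> distribution P1 Y A = distribution P2 Z A.

Definition exchangeable (d : measure_display) (Omega : measurableType d)
    (R : realType) (P : probability Omega R) (m : nat)
    (X : 'I_m -> {RV P >-> bool}) : Prop :=
  forall s : 'S_m, same_distribution (jointRV (fun i => X (s i))) (jointRV X).

Section coord.
Context (R : realType) (m : nat) (mu : probability (m.-tuple bool) R).

Definition coord_fun (i : 'I_m) (x : m.-tuple bool) : bool := tnth x i.

HB.instance Definition _ (i : 'I_m) :=
  isMeasurableFun.Build _ _ _ _ (coord_fun i) (measurable_tnth i).

Definition coordRV (i : 'I_m) : {RV mu >-> bool} := coord_fun i.

(* Every law [mu] on {0,1}^m is the joint distribution of its coordinates. *)
Lemma distribution_joint_coord :
  distribution mu (jointRV coordRV) = mu :> (set _ -> _).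
Proof.
apply/funext => A; rewrite /distribution /pushforward; congr (mu _).
apply/seteqP; split=> x /=;
  by rewrite (_ : joint_fun coordRV x = x) //; apply/eq_from_tnth => i;
     rewrite tnth_mktuple.
Qed.

End coord.

(* Main.v *)
(* An exchangeable law gives the same mass to any two tuples of the same weight,
   since such tuples are permutations of each other; so it spreads the mass
   P{sum = k} uniformly over the tuples of weight k. Conversely, spreading p k
   uniformly over each weight class gives an exchangeable law with the right
   sum. *)
From HB Require Import structures.
Require Import Defs.
From mathcomp Require Import all_boot all_algebra perm.
From mathcomp Require Import all_classical all_reals all_analysis.

Import GRing.Theory Num.Theory.

Local Open Scope classical_set_scope.
Local Open Scope ring_scope.

(** * Measures and finitely many atoms *)

Lemma range_bigcup1 (I T : Type) (a : I -> T) :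
  range a = \bigcup_(i in setT) [set a i].
Proof. by apply/seteqP; split=> [_ [i _ <-]|x [i _ ->]]; exists i. Qed.

(** Finite additivity: injectivity of [a] makes the singletons [[set a i]] disjoint, and each of
    them either lies in [A] or misses it. *)
Lemma measure_setI_range (d : measure_display) (T : measurableType d)
    (R : realType) (nu : {measure set T -> \bar R}) (I : finType) (a : I -> T) :
    injective a -> (forall i, measurable [set a i]) ->
  forall A, measurable A ->
    nu (A `&` range a) = (\sum_(i | a i \in A) nu [set a i])%E.
Proof.
move=> a_inj a_meas A mA.
rewrite range_bigcup1 setI_bigcupr measure_fin_bigcup //.
- rewrite (_ : [set: I] = [set` enum I]); last first.
    by apply/seteqP; split=> // i _ /=; rewrite mem_enum.
  rewrite -fsbig_seq ?enum_uniq // big_enum /= [RHS]big_mkcond /=.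
  apply: eq_bigr => i _.
  case: ifPn => [|/negP]; rewrite inE => Aai.
    by congr (nu _); apply/seteqP; split=> [x []//|x ->].
  rewrite (_ : _ `&` _ = set0) ?measure0 //.
  by apply/seteqP; split=> // x [Ax ax]; apply: Aai; rewrite -ax.
- exact: finite_finset.
- apply/trivIsetP => i j _ _ ij; apply/seteqP; split=> // x [[_ ->] [_ /a_inj]].
  by move/eqP; rewrite (negbTE ij).
- by move=> i _; exact: measurableI.
Qed.

(** Since the atoms carry the whole mass 1, the complement of [range a] is null, and so is the part
    of [A] outside the range. This serves for the law of [S], about which only the masses of the
    points [k%:R] are given. *)
Lemma probability_fin_atoms (d : measure_display) (T : measurableType d)
    (R : realType) (nu : probability T R) (I : finType) (a : I -> T) :
    injective a -> (forall i, measurable [set a i]) ->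
    (\sum_i nu [set a i] = 1)%E ->
  forall A, measurable A -> nu A = (\sum_(i | a i \in A) nu [set a i])%E.
Proof.
move=> a_inj a_meas nu1 A mA.
have mrange : measurable (range a).
  rewrite range_bigcup1.
  by apply: fin_bigcup_measurable => // *; exact: finite_finset.
have nu_range : nu (range a) = 1%E.
  rewrite -[range a]setTI measure_setI_range // -[RHS]nu1.
  by apply: eq_bigl => i; rewrite in_setT.
rewrite -(measure_setI_range _ _ _ nu) // (measureDI nu mA mrange).
rewrite [X in (X + _)%E](_ : _ = 0%E) ?add0e //.
have nu0 : nu (~` range a) = 0%E by rewrite probability_setC // nu_range subee.
apply: (subset_measure0 _ _ _ nu0) => //.
- exact: measurableD.
- exact: measurableC.
Qed.

(** Once the underlying functions are identified, the two packed structures differ only in proofs of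
    propositions, which proof irrelevance equates. *)
Lemma eq_probability (d : measure_display) (T : measurableType d)
    (R : realType) (mu nu : probability T R) :
  mu = nu :> (set T -> \bar R) -> mu = nu.
Proof.
case: mu nu => [f cf] [g cg] /= fg; case: _ / fg in cg *.
congr Probability.Pack.
case: cf cg => [[p1 p2] [p3] [p4] [p5] [p6] [p7] [p8]]
  [[q1 q2] [q3] [q4] [q5] [q6] [q7] [q8]].
rewrite (Prop_irrelevance q1 p1) (Prop_irrelevance q2 p2).
rewrite (Prop_irrelevance q3 p3) (Prop_irrelevance q4 p4).
rewrite (Prop_irrelevance q5 p5) (Prop_irrelevance q6 p6).
by rewrite (Prop_irrelevance q7 p7) (Prop_irrelevance q8 p8).
Qed.

(** The witness is the sum of the Dirac masses at the points [a i], scaled by [q i]. *)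
Lemma discrete_probability_exists (d : measure_display) (T : measurableType d)
    (R : realType) (I : finType) (a : I -> T) (q : I -> R) :
    (forall i, 0 <= q i) -> \sum_i q i = 1 ->
  exists mu : probability T R,
    forall A, mu A = (\sum_(i | a i \in A) (q i)%:E)%E.
Proof.
move=> q_ge0 q_sum.
pose mi i : {measure set T -> \bar R} := mscale (NngNum (q_ge0 i)) \d_(a i).
pose m0 : {measure set T -> \bar R} := mzero.
(* [msum] adds up a sequence indexed by [nat], so the family [mi] is enumerated; the default [m0] is
   never reached, as only indices below [#|I|] are summed. *)
pose mk k : {measure set T -> \bar R} := nth m0 (map mi (enum I)) k.
have msumE A : msum mk #|I| A = (\sum_(i | a i \in A) (q i)%:E)%E.
  rewrite /msum -(big_mkord xpredT (fun k => mk k A)).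
  rewrite cardE -(size_map mi).
  rewrite -(big_nth m0 xpredT (fun nu : {measure set T -> \bar R} => nu A)).
  rewrite big_map big_enum /= [RHS]big_mkcond; apply: eq_bigr => i _.
  by rewrite /mi /mscale /= diracE; case: ifP; rewrite ?mule1 ?mule0.
have msumT : msum mk #|I| setT = 1%E.
  by rewrite msumE -q_sum -sumEFin; apply: eq_bigl => i; rewrite in_setT.
pose hP := Measure_isProbability.Build _ _ _ (msum mk #|I|) msumT.
pose mu : probability T R := HB.pack (msum mk #|I|) hP.
by exists mu => A; exact: msumE.
Qed.

(** * Bit tuples, their weight and their permutations *)

Section tuples.
Set Implicit Arguments.
Unset Strict Implicit.
Variables (R : realType) (m : nat).
Implicit Types (x y : m.-tuple bool) (s : 'S_m).

(** Valued in ['I_m.+1] to serve as an argument of [p]; a count never exceeds [m], so [inord] never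
    falls back on its default. *)
Definition weight x : 'I_m.+1 := inord (count id x).

Lemma weightE x : weight x = count id x :> nat.
Proof. by rewrite inordK // ltnS -[leqRHS](size_tuple x) count_size. Qed.

Lemma sum_tnth_weight x : \sum_(i < m) (tnth x i)%:R = (weight x)%:R :> R.
Proof.
rewrite weightE -sum1_count natr_sum big_tuple [RHS]big_mkcond /=.
by apply: eq_bigr => i _; case: (tnth _ _).
Qed.

(** Ensures that no weight class is empty, so that one may divide by its size. *)
Lemma weight_surj (k : 'I_m.+1) : exists x, weight x = k.
Proof.
have sz : size (nseq k true ++ nseq (m - k) false) == m.
  by rewrite size_cat !size_nseq subnKC // -ltnS.
exists (Tuple sz); apply: val_inj; rewrite /= weightE /=.
by rewrite count_cat !count_nseq /= mul1n mul0n addn0.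
Qed.

Definition permute_tuple s x : m.-tuple bool := [tuple tnth x (s i) | i < m].

Lemma permute_tupleK s : cancel (permute_tuple s) (permute_tuple s^-1%g).
Proof. by move=> x; apply/eq_from_tnth => i; rewrite !tnth_mktuple permKV. Qed.

Lemma weight_permute s x : weight (permute_tuple s x) = weight x.
Proof.
apply: val_inj; rewrite /= !weightE; apply/seq.permP; apply/tuple_permP.
by exists s.
Qed.

(** Over [bool] the number of [true] entries also fixes the number of [false] ones, hence the whole
    multiset of entries. *)
Lemma weight_eq_permute x y : weight x = weight y ->
  exists s, x = permute_tuple s y.
Proof.
move=> /(congr1 val) /=; rewrite !weightE => xy.
have /tuple_permP[s xs] : perm_eq x y.
  apply/allP => b _ /=; apply/eqP.
  have cntN z : count_mem false z = (size z - count id z)%N.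
    by rewrite -(count_predC id z) addKn; apply: eq_count => -[].
  have cntT z : count_mem true z = count id z by apply: eq_count => -[].
  by case: b; rewrite ?cntT ?cntN ?xy ?size_tuple.
by exists s; apply: val_inj.
Qed.

(** A point is a finite intersection of coordinate cylinders. *)
Lemma measurable_set1_tuple x : measurable [set x].
Proof.
rewrite (_ : [set x] =
    \bigcap_(i in setT) ((@tnth _ _)^~ i @^-1` [set tnth x i])).
  apply: fin_bigcap_measurable => // i _; rewrite -[X in measurable X]setTI.
  exact: measurable_tnth.
apply/seteqP; split=> [_ -> //|y xy]; apply/eq_from_tnth => i.
exact: xy.
Qed.

Lemma measurable_set_tuple (A : set (m.-tuple bool)) : measurable A.
Proof.
rewrite (_ : A = \bigcup_(x in A) [set x]).
  apply: fin_bigcup_measurable => [|x _]; first exact: finite_finset.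
  exact: measurable_set1_tuple.
by apply/seteqP; split=> [x Ax|x [_ Ay ->//]]; exists x.
Qed.

Lemma measure_tuple_atoms (nu : {measure set (m.-tuple bool) -> \bar R}) A :
  nu A = (\sum_(x | x \in A) nu [set x])%E.
Proof.
rewrite -[in LHS](setIT A) -[in LHS](image_id setT).
apply: measure_setI_range => //; first exact: measurable_set1_tuple.
exact: measurable_set_tuple.
Qed.

(** The joint law of the permuted coordinates is the image of [nu] under [permute_tuple s], and
    every set of tuples is measurable. *)
Lemma exchangeable_coordP (nu : probability (m.-tuple bool) R) :
  exchangeable (coordRV nu) <->
  forall s A, nu (permute_tuple s @^-1` A) = nu A.
Proof.
have jointE s A : distribution nu (jointRV (fun i => coordRV nu (s i))) A =
    nu (permute_tuple s @^-1` A) by [].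
split=> [nu_exch s A|nu_inv s A mA].
  by rewrite -jointE (nu_exch s A (measurable_set_tuple A))
             (distribution_joint_coord nu).
by rewrite jointE nu_inv (distribution_joint_coord nu).
Qed.

Lemma distribution_sum_coord (nu : probability (m.-tuple bool) R) A :
  distribution nu (sumRV (coordRV nu)) A = nu [set x | A (weight x)%:R].
Proof.
rewrite /distribution /pushforward; congr (nu _); apply/seteqP.
by split=> x /=; rewrite /sum_fun sum_tnth_weight.
Qed.

(** * Spreading mass evenly over weight classes *)

Definition class_size (k : 'I_m.+1) := #|[pred x | weight x == k]|.

Lemma class_size_neq0 k : (class_size k)%:R != 0 :> R.
Proof.
rewrite pnatr_eq0 -lt0n; have [x xk] := weight_surj k.
by apply/card_gt0P; exists x; rewrite inE xk.
Qed.

Definition exch_pmf (p : 'I_m.+1 -> R) x : R :=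
  p (weight x) / (class_size (weight x))%:R.

Lemma sum_exch_pmf p k : \sum_(x | weight x == k) exch_pmf p x = p k.
Proof.
rewrite (eq_bigr (fun=> p k / (class_size k)%:R)) => [|x /eqP xk].
  rewrite sumr_const -[_ *+ #|_|]mulr_natr -/(class_size k).
  by rewrite divfK ?class_size_neq0.
by rewrite /exch_pmf xk.
Qed.

(** The core of uniqueness: all atoms of a weight class have equal mass, so [p k] is [class_size k]
    times that common mass. *)
Lemma exchangeable_atom (nu : probability (m.-tuple bool) R)
    (p : 'I_m.+1 -> R) : exchangeable (coordRV nu) ->
    (forall k, nu [set x | weight x = k] = (p k)%:E) ->
  forall x, nu [set x] = (exch_pmf p x)%:E.
Proof.
move=> /exchangeable_coordP nu_inv nu_weight x.
have nu_class y : weight y = weight x -> nu [set y] = nu [set x].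
  move=> /weight_eq_permute[s ->]; rewrite -(nu_inv s [set permute_tuple s x]).
  congr (nu _); apply/seteqP; split=> [z|z -> //] /=.
  exact: (can_inj (permute_tupleK s)).
(* Finiteness allows the equation to be moved from [\bar R] to [R], where it can be divided by the
   class size. *)
have nux_fin : nu [set x] \is a fin_num.
  exact: fin_num_measure (measurable_set1_tuple x).
have := nu_weight (weight x); rewrite measure_tuple_atoms.
rewrite (eq_bigl (fun y => weight y == weight x)) => [|y]; last first.
  by apply/idP/eqP; rewrite inE.
rewrite (eq_bigr (fun=> (fine (nu [set x]))%:E)) => [|y /eqP yx]; last first.
  by rewrite fineK //; exact: nu_class.
rewrite sumEFin sumr_const -/(class_size (weight x)) => -[pE].
by rewrite /exch_pmf -pE -[_ *+ _]mulr_natr mulfK ?class_size_neq0 // fineK.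
Qed.

End tuples.

Theorem proposition2 (R : realType) (m : nat) (m_gt0 : (0 < m)%N)
    (p : 'I_m.+1 -> R) (p_ge0 : forall k : 'I_m.+1, 0 <= p k)
    (p_sum : \sum_(k < m.+1) p k = 1)
    (d : measure_display) (Omega : measurableType d) (P : probability Omega R)
    (S : {RV P >-> R})
    (S_law : forall k : 'I_m.+1, P [set w | S w = k%:R] = (p k)%:E) :
  exists! mu : probability (m.-tuple bool) R,
    exchangeable (coordRV mu) /\ same_distribution (sumRV (coordRV mu)) S.
Proof.
have pmf_ge0 x : 0 <= exch_pmf p x by rewrite divr_ge0.
have pmf_sum : \sum_x exch_pmf p x = 1.
  rewrite (partition_big (@weight m) xpredT) //= -p_sum.
  by apply: eq_bigr => k _; rewrite sum_exch_pmf.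
have [mu muE] :=
  discrete_probability_exists _ (m.-tuple bool) R _ id _ pmf_ge0 pmf_sum.
(* [B] is arbitrary because it will be the set of weights whose real value falls in a given
   measurable set. *)
have mu_weight (B : set 'I_m.+1) : mu [set x | B (weight x)] =
    (\sum_(k | k \in B) (p k)%:E)%E.
  rewrite muE (partition_big (@weight m) (mem B)) /= => [|x];
    last by rewrite !inE.
  apply: eq_bigr => k; rewrite inE => Bk; rewrite -(sum_exch_pmf p) -sumEFin.
  apply: eq_bigl => x; apply/andP/eqP => [[_ /eqP//]|xk].
  by rewrite inE /= xk eqxx.
exists mu; split=> [|nu [nu_exch nu_law]]; [split|].
- apply/exchangeable_coordP => s A; rewrite !muE.
  (* [permute_tuple s] is a bijection under which [exch_pmf] is invariant. *)
  rewrite [RHS](reindex_inj (can_inj (permute_tupleK s))) /=.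
  apply: eq_big => [x|x _]; last by rewrite /exch_pmf weight_permute.
  by apply/idP/idP; rewrite !inE.
- move=> A mA; rewrite distribution_sum_coord (mu_weight [set k | A k%:R]).
  (* As the [p k] sum to 1, the law of [S] is concentrated on the points [0, ..., m]. *)
  rewrite (@probability_fin_atoms _ _ _ (distribution P S) _
    (fun k : 'I_m.+1 => k%:R)) //.
  + apply: eq_big => [k|k _]; last by rewrite -S_law.
    by apply/idP/idP; rewrite !inE.
  + by move=> i j /eqP; rewrite eqr_nat => /eqP/val_inj.
  + by rewrite (eq_bigr (fun k => (p k)%:E)) ?sumEFin ?p_sum // => k _;
      rewrite -S_law.
- have nuE : mu = nu :> (set _ -> _).
    apply/funext => A; rewrite (measure_tuple_atoms nu) muE.
    apply: eq_bigr => x _; apply/esym/exchangeable_atom => // k.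
    (* Testing equality of laws on one point recovers the mass of one weight class, since distinct
       naturals stay distinct in [R]. *)
    have := nu_law [set k%:R] (measurable_set1 _).
    rewrite distribution_sum_coord [RHS](_ : _ = (p k)%:E); last exact: S_law.
    move=> <-; congr (nu _); apply/seteqP; split=> y /= [].
      by move=> ->.
    by move=> /eqP; rewrite eqr_nat => /eqP/val_inj.
  exact: eq_probability.
Qed.
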